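(* Let $d=2^r$ for some positive integer $r$. Let $\mathcal{T}=(T^i)_{i=1}^d$ be the family of subsets of $\{1,\dots,2d\}$ given by $T^i=\{2i-3,2i-2,2i-1,2i\}$, where the indices $-1$ and $0$ are identified with $2d-1$ and $2d$, respectively (so $T^1=\{2d-1,2d,1,2\}$). Let $H^{\mathrm{br}}_d=(h^i)_{i=1}^d$ be the binary reflected Gray encoding, and set $h^{d+1}:=h^1$. Then $(\lambda,z)\in Q(\mathcal{T},H^{\mathrm{br}}_d)$ if and only if $$\sum_{i=1}^d\min\{h^i_k,h^{i+1}_k\}(\lambda_{2i-1}+\lambda_{2i})\ \le\ z_k\ \le\ \sum_{i=1}^d\max\{h^i_k,h^{i+1}_k\}(\lambda_{2i-1}+\lambda_{2i})\qquad\text{for all }k\in\{1,\dots,r\},$$ $$(\lambda,z)\in\Delta^{2d}\times\mathbb{R}^r.$$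
   Context: $\Delta^N=\{\lambda\in\mathbb{R}^N_{\ge0}:\sum_v\lambda_v=1\}$. For $T\subseteq\{1,\dots,N\}$, $P(T)=\{\lambda\in\Delta^N:\lambda_v\ne0\text{ only if }v\in T\}$. For a family $\mathcal{T}=(T^i)_{i=1}^d$ of subsets of $\{1,\dots,N\}$ and pairwise distinct vectors $H=(h^i)_{i=1}^d$ in $\mathbb{R}^r$, $Q(\mathcal{T},H)=\operatorname{Conv}\big(\bigcup_{i=1}^d(P(T^i)\times\{h^i\})\big)\subseteq\mathbb{R}^N\times\mathbb{R}^r$. $h^i_k$ is the $k$-th component of $h^i$. Binary reflected Gray encoding: define $K^s\in\{0,1\}^{2^s\times s}$ recursively by $K^1=(0,1)^T$ and $$K^{s+1}=\begin{pmatrix}K^s&\mathbf{0}\\ \operatorname{rev}(K^s)&\mathbf{1}\end{pmatrix},$$ where $\mathbf{0},\mathbf{1}$ are the all-zeros and all-ones column vectors of length $2^s$ and $\operatorname{rev}(A)$ reverses the order of the rows of $A$. For $d=2^r$, $H^{\mathrm{br}}_d=(h^i)_{i=1}^d$ where $h^i$ is the $i$-th row of $K^r$. (The family $\mathcal{T}$ encodes the relaxation of the annulus in the plane by a cyclic ring of $d$ quadrilaterals with $2d$ vertices in total, consecutive quadrilaterals sharing two vertices.) *)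

(* Defs.v *)
From mathcomp Require Import all_boot all_order all_algebra.
From mathcomp Require Import boolp classical_sets reals convex.

Set Implicit Arguments.
Unset Strict Implicit.
Unset Printing Implicit Defensive.

Import Order.TTheory GRing.Theory Num.Theory.
Local Open Scope classical_set_scope.
Local Open Scope ring_scope.

(* All indices are shifted to start at 0: the one-based v in {1, ..., N} is    *)
(* the ordinal v - 1 of 'I_N, and likewise for i and k.                        *)

Section Embedding.
Variable R : realType.

Definition simplex (N : nat) : set 'rV[R]_N :=
  [set lam | (forall v, 0 <= lam 0 v) /\ \sum_v lam 0 v = 1].

Definition face (N : nat) (T : {set 'I_N}) : set 'rV[R]_N :=
  [set lam | simplex lam /\ forall v, lam 0 v != 0 -> v \in T].

Definition convex_hull (E : lmodType R) (A : set (convex_lmodType E)) :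
    set (convex_lmodType E) :=
  smallest (@convex_set R E) A.

(* H is not required to be injective here: the rows of the Gray encoding are   *)
(* pairwise distinct.                                                          *)
Definition Q (N r d : nat) (T : 'I_d -> {set 'I_N}) (H : 'I_d -> 'rV[R]_r) :
    set ('rV[R]_N * 'rV[R]_r) :=
  convex_hull (\bigcup_i (face (T i) `*` [set H i])).

Lemma gray_rows (s : nat) : (2 ^ s + 2 ^ s = 2 ^ s.+1)%N.
Proof. by rewrite addnn -mul2n -expnS. Qed.

Definition gray_step (s : nat) (K : 'M[R]_((2 ^ s)%N, s)) :
    'M[R]_((2 ^ s.+1)%N, s.+1) :=
  castmx (gray_rows s, addn1 s)
    (block_mx K                      (const_mx 0)
              (rowsub (@rev_ord _) K) (const_mx 1)).

(* gray_succ s is K^(s+1).                                                     *)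
Fixpoint gray_succ (s : nat) : 'M[R]_((2 ^ s.+1)%N, s.+1) :=
  match s with
  | 0 => \matrix_(i < 2, j < 1) (i : nat)%:R
  | t.+1 => gray_step (gray_succ t)
  end.

(* gray s is K^s; the value at s = 0 is an irrelevant 1 x 0 matrix.            *)
Definition gray (s : nat) : 'M[R]_((2 ^ s)%N, s) :=
  match s with
  | 0 => 0
  | t.+1 => gray_succ t
  end.

Definition gray_code (r : nat) (i : 'I_(2 ^ r)) : 'rV[R]_r := row i (gray r).

End Embedding.

Lemma vtx1_subproof (d : nat) (i : 'I_d) : (2 * i < 2 * d)%N.
Proof. by rewrite ltn_pmul2l. Qed.

Lemma vtx2_subproof (d : nat) (i : 'I_d) : ((2 * i).+1 < 2 * d)%N.
Proof. by rewrite !mul2n ltn_Sdouble. Qed.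

(* In one-based numbering, vtx1 i and vtx2 i are the vertices 2i-1 and 2i.     *)
Definition vtx1 (d : nat) (i : 'I_d) : 'I_(2 * d) := Ordinal (vtx1_subproof i).
Definition vtx2 (d : nat) (i : 'I_d) : 'I_(2 * d) := Ordinal (vtx2_subproof i).

(* T^i = {2i-3, 2i-2, 2i-1, 2i} with 2i-3 = 2(i-1)-1 and 2i-2 = 2(i-1); the    *)
(* cyclic predecessor ord_pred performs the identifications of -1 and 0 with   *)
(* 2d-1 and 2d.                                                                *)
Definition annulus (d : nat) (i : 'I_d) : {set 'I_(2 * d)} :=
  [set vtx1 (ord_pred i); vtx2 (ord_pred i); vtx1 i; vtx2 i].

(* Main.v *)
Require Import Defs.
From mathcomp Require Import all_boot all_order all_algebra.
From mathcomp Require Import boolp classical_sets reals convex interval_inference.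
From mathcomp Require Import ring lra zify.

Set Implicit Arguments.
Unset Strict Implicit.
Unset Printing Implicit Defensive.

Import Order.TTheory GRing.Theory Num.Theory.
Local Open Scope classical_set_scope.
Local Open Scope ring_scope.

(** The vertices of the ring come in pairs, one pair for each edge shared by two
    consecutive quadrilaterals: the pair [vtx1 i, vtx2 i] lies exactly in the
    quadrilaterals [i] and [ordS i].  A point of the hull is obtained by
    splitting the weight [mass lam i] of every pair between these two
    quadrilaterals, so the vectors [z] that go with a given [lam] form the
    Minkowski sum of the segments joining [H i] to [H (ordS i)], scaled by
    [mass lam i].

    Cyclically consecutive codes of the reflected Gray encoding differ in a
    single coordinate ([gray_cyclic]), so each of these segments is parallel to
    an axis and therefore equals the box spanned by its end points
    ([box_segment]).  A Minkowski sum of boxes is the box whose lower and upper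
    corners are the sums of the lower and upper corners, and the stated
    inequalities say that [z] lies in this box.

    The hull satisfies the inequalities because they define a convex set
    ([convex_annulus_ineqs]) that contains the generators
    ([face_annulus_ineqs]).  For the converse
    ([annulus_ineqs_hull]) the decomposition of a point of the sum of boxes is
    explicit ([box_weights]): in coordinate [k] all the boxes use the ratio in
    which [z 0 k] divides the interval between its two bounds. *)

(** * Convex combinations *)

Lemma convex_set_conv (R : numDomainType) (E : lmodType R)
    (A : set (convex_lmodType E)) (t : R) (x y : E) :
  convex_set A -> 0 <= t <= 1 -> A x -> A y -> A (t *: x + (1 - t) *: y).
Proof.
move=> cA /andP[t0 t1] Ax Ay.
have := cA x y (Itv01 t0 t1); rewrite !inE; exact.
Qed.

(** Rescaling partial sums to total weight 1 fails for a partial sum of weight 0;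
    the induction therefore runs over the cone spanned by [A], whose points of
    weight [c] are [0] when [c = 0] and [c *: a] with [a] in [A] when [0 < c]. *)
Lemma convex_set_sum (R : numFieldType) (E : lmodType R)
    (A : set (convex_lmodType E)) (I : finType) (w : I -> R) (x : I -> E) :
  convex_set A -> (forall i, 0 <= w i) -> \sum_i w i = 1 ->
  (forall i, A (x i)) -> A (\sum_i w i *: x i).
Proof.
move=> cA w0 w1 Ax.
pose K (c : R) (v : E) := (c = 0 /\ v = 0) \/ (0 < c /\ A (c^-1 *: v)).
have : K (\sum_i w i) (\sum_i w i *: x i).
  apply: (big_ind2 K); first by left.
  - move=> c u c' u' [[-> ->]|[c0 Au]]; first by rewrite !add0r.
    case=> [[-> ->]|[c'0 Au']]; first by rewrite !addr0; right.
    have s0 := addr_gt0 c0 c'0.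
    right; split=> //.
    have -> : (c + c')^-1 *: (u + u') =
      (c / (c + c')) *: (c^-1 *: u) + (1 - c / (c + c')) *: (c'^-1 *: u').
      rewrite !scalerA scalerDr; congr (_ *: _ + _ *: _).
        by field; rewrite !gt_eqF.
      by field; rewrite !gt_eqF.
    apply: convex_set_conv => //; rewrite divr_ge0 ?(ltW c0) ?(ltW s0) //=.
    by rewrite ler_pdivrMr // mul1r lerDl ltW.
  - move=> i _; have := w0 i; rewrite le_eqVlt => /predU1P[<-|wi0].
      by left; rewrite scale0r.
    by right; rewrite scalerA mulVf ?gt_eqF // scale1r.
rewrite w1 => -[[/eqP]|[_]]; first by rewrite oner_eq0.
by rewrite invr1 scale1r.
Qed.


Lemma between_conv (R : realFieldType) (a b c : R) :
  Num.min a b <= c <= Num.max a b ->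
  exists t, 0 <= t <= 1 /\ c = t * a + (1 - t) * b.
Proof.
wlog le_ab : a b / a <= b => [hw|].
  case/orP: (le_total a b) => [/hw//|le_ba].
  rewrite minC maxC => /(hw _ _ le_ba)[t [t01 ->]].
  by exists (1 - t); split; [lra | ring].
rewrite min_l // max_r // => acb.
have [eq_ab|ne_ab] := eqVneq a b.
  by exists 0; split; [lra | subst b; lra].
have ab0 : 0 < b - a by rewrite subr_gt0 lt_neqAle ne_ab.
exists ((b - c) / (b - a)); split.
  by rewrite divr_ge0 ?ler_pdivrMr //; lra.
by field; rewrite gt_eqF.
Qed.

Lemma conv_between (R : realFieldType) (a b t : R) :
  0 <= t <= 1 ->
  Num.min a b <= t * Num.min a b + (1 - t) * Num.max a b <= Num.max a b.
Proof.
have : Num.min a b <= Num.max a b by rewrite ge_min !le_max !lexx.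
move: (Num.min a b) (Num.max a b) => m M; nra.
Qed.

(** * Axis-parallel segments *)

(** Equality is included: [x] and [y] differ in at most one coordinate. *)
Definition differ_once (R : Type) (r : nat) (x y : 'rV[R]_r) : Prop :=
  exists k0, forall k, k != k0 -> x 0 k = y 0 k.

Lemma differ_once_sym (R : Type) (r : nat) (x y : 'rV[R]_r) :
  differ_once x y -> differ_once y x.
Proof. by case=> k0 h; exists k0 => k /h. Qed.

(** Away from the coordinate [k0] the box is degenerate, so the point is
    determined by where its coordinate [k0] divides the interval. *)
Lemma box_segment (R : realFieldType) (r : nat) (x y q : 'rV[R]_r) :
  differ_once x y ->
  (forall k, Num.min (x 0 k) (y 0 k) <= q 0 k <= Num.max (x 0 k) (y 0 k)) ->
  exists t, 0 <= t <= 1 /\ q = t *: x + (1 - t) *: y.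
Proof.
case=> k0 xy bq; have [t [t01 qk0]] := between_conv (bq k0).
exists t; split=> //; apply/rowP => k; rewrite !mxE.
have [->//|/xy e] := eqVneq k k0.
by have := bq k; rewrite e minxx maxxx => /le_anti <-; ring.
Qed.

(** * The ring of quadrilaterals *)

Lemma sum_vtx (V : nmodType) (d : nat) (F : 'I_(2 * d) -> V) :
  \sum_v F v = \sum_i F (vtx1 i) + \sum_i F (vtx2 i).
Proof.
pose h (u : 'I_d + 'I_d) := match u with inl i => vtx1 i | inr i => vtx2 i end.
have hinj : injective h.
  by case=> i [] j /(congr1 val) /= e; [congr inl | | | congr inr];
    try apply: val_inj; rewrite /=; lia.
have hbij : bijective h.
  by apply: inj_card_bij hinj _; rewrite card_sum !card_ord; lia.
by rewrite (reindex h) ?big_sumType //; apply: onW_bij.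
Qed.

Definition mass (R : nmodType) (d : nat) (lam : 'rV[R]_(2 * d)) (i : 'I_d) : R :=
  lam 0 (vtx1 i) + lam 0 (vtx2 i).

Lemma sum_mass (R : nmodType) (d : nat) (lam : 'rV[R]_(2 * d)) :
  \sum_i mass lam i = \sum_v lam 0 v.
Proof. by rewrite sum_vtx -big_split. Qed.

Lemma sum_mass_conv (R : comPzRingType) (d : nat) (c : 'I_d -> R) (t : R)
    (u v : 'rV[R]_(2 * d)) :
  \sum_i c i * mass (t *: u + (1 - t) *: v) i =
  t * (\sum_i c i * mass u i) + (1 - t) * \sum_i c i * mass v i.
Proof.
rewrite !mulr_sumr -big_split; apply: eq_bigr => i _ /=.
by rewrite /mass !mxE; ring.
Qed.

Section Annulus.
Variables (R : realType) (d r : nat) (H : 'I_d -> 'rV[R]_r).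

Definition edge_min (k : 'I_r) (i : 'I_d) := Num.min (H i 0 k) (H (ordS i) 0 k).
Definition edge_max (k : 'I_r) (i : 'I_d) := Num.max (H i 0 k) (H (ordS i) 0 k).

Definition annulus_ineqs (lam : 'rV[R]_(2 * d)) (z : 'rV[R]_r) : Prop :=
  (forall k, \sum_i edge_min k i * mass lam i <= z 0 k
             <= \sum_i edge_max k i * mass lam i)
  /\ simplex lam.

Lemma convex_annulus_ineqs :
  @convex_set R ('rV[R]_(2 * d) * 'rV[R]_r)%type
    [set p | annulus_ineqs p.1 p.2].
Proof.
move=> [u x] [v y] l; rewrite !inE /= => -[ux [u0 u1]] [vy [v0 v1]].
have l01 : 0 <= l%:num <= 1 by apply/andP; split.
set t := l%:num in l01.
change (annulus_ineqs (t *: u + (1 - t) *: v) (t *: x + (1 - t) *: y)).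
split=> [k|].
  by rewrite !sum_mass_conv !mxE !lerD ?ler_wpM2l; move: (ux k) (vy k); nra.
split=> [i|]; first by rewrite !mxE; move: (u0 i) (v0 i); nra.
under eq_bigr do rewrite !mxE.
by rewrite big_split -!mulr_sumr u1 v1 /=; ring.
Qed.

(** The weight of a point of the quadrilateral [i] sits on the pairs [i] and
    [ord_pred i]; the segments attached to both have [H i] as an end point. *)
Lemma face_annulus_ineqs (i : 'I_d) (lam : 'rV[R]_(2 * d)) :
  face (annulus i) lam -> annulus_ineqs lam (H i).
Proof.
move=> [slam supp]; have [l0 l1] := slam; split=> // k.
have m0 j : 0 <= mass lam j by apply: addr_ge0.
have mE j : mass lam j != 0 -> (j == i) || (ordS j == i).
  apply: contraNT; rewrite negb_or => /andP[ji Sji].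
  suff z v : (v = vtx1 j) \/ (v = vtx2 j) -> lam 0 v = 0.
    by rewrite /mass !z ?addr0; auto.
  move=> vj; apply/eqP; apply: contraT => /supp; rewrite !inE.
  have pj : j != ord_pred i by apply: contraNneq Sji => ->; rewrite ord_predK.
  by move: ji pj; rewrite -!val_eqE /=; case: vj => -> /=; lia.
have -> : H i 0 k = \sum_j H i 0 k * mass lam j.
  by rewrite -mulr_sumr sum_mass l1 mulr1.
apply/andP; split; apply: ler_sum => j _.
  have [->|/mE] := eqVneq (mass lam j) 0; first by rewrite !mulr0.
  by case/orP=> /eqP <-; rewrite ler_wpM2r // /edge_min ge_min lexx ?orbT.
have [->|/mE] := eqVneq (mass lam j) 0; first by rewrite !mulr0.
by case/orP=> /eqP <-; rewrite ler_wpM2r // /edge_max le_max lexx ?orbT.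
Qed.

Lemma simplex_vertex (N : nat) (v : 'I_N) : simplex ('e_v : 'rV[R]_N).
Proof.
split=> [w|]; first by rewrite mxE ler0n.
rewrite (bigD1 v) //= big1 => [|w wv]; first by rewrite mxE !eqxx addr0.
by rewrite mxE (negbTE wv) andbF.
Qed.

Lemma face_vertex (N : nat) (T : {set 'I_N}) (v : 'I_N) :
  v \in T -> face T ('e_v : 'rV[R]_N).
Proof.
move=> vT; split; first exact: simplex_vertex.
move=> w; rewrite mxE eqxx /=.
by case: (w =P v) => [->//|_]; rewrite eqxx.
Qed.

Hypothesis adj : forall i, differ_once (H i) (H (ordS i)).

(** A point of a Minkowski sum of boxes is a sum of points of the boxes: in each
    coordinate, the ratio in which it divides the sum of the intervals is used
    inside every summand. *)
Lemma box_weights (lam : 'rV[R]_(2 * d)) (z : 'rV[R]_r) :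
  annulus_ineqs lam z ->
  exists q : 'I_d -> 'rV[R]_r,
    (forall i k, edge_min k i <= q i 0 k <= edge_max k i) /\
    z = \sum_i mass lam i *: q i.
Proof.
case=> bz _.
have /choice[t tP] k : exists t, 0 <= t <= 1 /\
    z 0 k = t * (\sum_i edge_min k i * mass lam i)
            + (1 - t) * \sum_i edge_max k i * mass lam i.
  apply: between_conv; have /andP[Lz zU] := bz k.
  by rewrite ge_min le_max Lz zU orbT.
exists (fun i => \row_k (t k * edge_min k i + (1 - t k) * edge_max k i)).
split=> [i k|]; first by rewrite mxE conv_between //; case: (tP k).
apply/rowP => k; case: (tP k) => _ ->; rewrite summxE !mulr_sumr -big_split.
by apply: eq_bigr => i _ /=; rewrite !mxE; ring.
Qed.

(** With [q] as in [box_weights], [(lam, z)] is the combination, with weights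
    [lam 0 v], of the points [('e_v, q i)] for [v] in the pair [i].  Each of
    these lies on the segment from [('e_v, H i)] to [('e_v, H (ordS i))], whose
    end points are generators because [v] belongs to both quadrilaterals. *)
Lemma annulus_ineqs_hull (lam : 'rV[R]_(2 * d)) (z : 'rV[R]_r) :
  annulus_ineqs lam z -> Q (@annulus d) H (lam, z).
Proof.
move=> bz; have [q [bq zE]] := box_weights bz; have [_ [l0 l1]] := bz.
move=> A [cA genA].
have vA (v : 'I_(2 * d)) i : v \in annulus i -> A ('e_v, H i).
  by move=> vi; apply: genA; exists i => //; split=> //; apply: face_vertex.
have qA i v : (v == vtx1 i) || (v == vtx2 i) -> A ('e_v, q i).
  move=> vi; have [t [t01 ->]] := box_segment (adj i) (bq i).
  have -> : ('e_v, t *: H i + (1 - t) *: H (ordS i)) =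
            t *: ('e_v, H i) + (1 - t) *: ('e_v, H (ordS i))
         :> 'rV[R]_(2 * d) * 'rV[R]_r.
    by rewrite [RHS]surjective_pairing /= -scalerDl [t + _]addrC subrK scale1r.
  apply: convex_set_conv => //; apply: vA; rewrite !inE ?ordSK;
    by case/orP: vi => /eqP ->; rewrite eqxx ?orbT.
pose w (u : 'I_d + 'I_d) :=
  match u with inl i => lam 0 (vtx1 i) | inr i => lam 0 (vtx2 i) end.
pose x (u : 'I_d + 'I_d) : 'rV[R]_(2 * d) * 'rV[R]_r :=
  match u with inl i => ('e_(vtx1 i), q i) | inr i => ('e_(vtx2 i), q i) end.
have -> : (lam, z) = \sum_u w u *: x u.
  rewrite [RHS]surjective_pairing; congr (_, _).
    by rewrite [LHS]row_sum_delta raddf_sum /= sum_vtx big_sumType.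
  rewrite zE raddf_sum big_sumType /= -big_split.
  by apply: eq_bigr => i _ /=; rewrite -scalerDl.
apply: convex_set_sum => //.
- by case=> i; apply: l0.
- by rewrite big_sumType -l1 sum_vtx.
- by case=> i; apply: qA; rewrite eqxx ?orbT.
Qed.

Lemma Q_annulus (lam : 'rV[R]_(2 * d)) (z : 'rV[R]_r) :
  Q (@annulus d) H (lam, z) <-> annulus_ineqs lam z.
Proof.
split; last exact: annulus_ineqs_hull.
apply: (smallest_sub convex_annulus_ineqs) => -[u x] [i _ [fu /= ->]].
exact: face_annulus_ineqs.
Qed.

End Annulus.

(** * The reflected Gray code *)

Section Gray.
Variable R : realType.

Section Step.
Variables (s : nat) (K : 'M[R]_(2 ^ s, s)).
Implicit Types (i : 'I_(2 ^ s.+1)) (j : 'I_(2 ^ s)).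

(** The rows of the next code repeat the rows of [K] forwards and then
    backwards; [folds i j] says that row [i] is one of the two copies of row
    [j]: the sum of mirror indices is [(2 ^ s.+1).-1]. *)
Definition folds i j : Prop := i = j :> nat \/ (i + j).+1 = (2 ^ s.+1)%N.

Lemma gray_step_body i j (k : 'I_s.+1) (k' : 'I_s) :
  folds i j -> k = k' :> nat -> gray_step K i k = K j k'.
Proof.
move=> ij kk'; rewrite castmxE.
have -> : cast_ord (esym (addn1 s)) k = lshift 1 k' by apply: val_inj.
set i' := cast_ord _ i; have i'E : i' = i :> nat by [].
have j2 := ltn_ord j; have e2 := gray_rows s.
case: (split_ordP i') => u uE; rewrite uE ?block_mxEul ?block_mxEdl ?mxE.
  have := congr1 val uE; rewrite /= => iu; congr (K _ _); apply: val_inj => /=.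
  by have := ltn_ord u; case: ij; lia.
have := congr1 val uE; rewrite /= => iu; congr (K _ _); apply: val_inj => /=.
by have := ltn_ord u; case: ij; lia.
Qed.

Lemma gray_step_last i (k : 'I_s.+1) :
  k = s :> nat -> gray_step K i k = (2 ^ s <= i)%:R.
Proof.
move=> ks; rewrite castmxE.
have -> : cast_ord (esym (addn1 s)) k = rshift s (ord0 : 'I_1).
  by apply: val_inj; rewrite /= addn0.
set i' := cast_ord _ i; have i'E : i' = i :> nat by [].
case: (split_ordP i') => u uE; rewrite uE ?block_mxEur ?block_mxEdr mxE;
  have := congr1 val uE; have := ltn_ord u; rewrite /= => ul iu.
  by rewrite leqNgt (_ : (i < _)%N) //; lia.
by rewrite (_ : (_ <= i)%N) //; lia.
Qed.

Lemma differ_once_same_half i1 i2 j1 j2 :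
  folds i1 j1 -> folds i2 j2 -> (2 ^ s <= i1)%N = (2 ^ s <= i2)%N ->
  differ_once (row j1 K) (row j2 K) ->
  differ_once (row i1 (gray_step K)) (row i2 (gray_step K)).
Proof.
move=> f1 f2 e [k0 d0]; exists (widen_ord (leqnSn s) k0) => k.
rewrite -val_eqE /= !mxE => kk0.
have [ks|ks] := ltnP k s; last first.
  have {}ks : k = s :> nat by have := ltn_ord k; lia.
  by rewrite !gray_step_last // e.
rewrite (@gray_step_body i1 j1 k (Ordinal ks)) //.
rewrite (@gray_step_body i2 j2 k (Ordinal ks)) //.
by have := d0 (Ordinal ks); rewrite !mxE; apply; rewrite -val_eqE.
Qed.

Lemma differ_once_mirror i1 i2 j :
  folds i1 j -> folds i2 j ->
  differ_once (row i1 (gray_step K)) (row i2 (gray_step K)).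
Proof.
move=> f1 f2; exists ord_max => k; rewrite -val_eqE /= !mxE => kk0.
have ks : (k < s)%N by have := ltn_ord k; lia.
rewrite (@gray_step_body i1 j k (Ordinal ks)) //.
by rewrite (@gray_step_body i2 j k (Ordinal ks)).
Qed.

End Step.

(** Inside a half, two neighbours come from two neighbours of the smaller code,
    in reverse order in the second half; at the boundary they are the two copies
    of the same row, so that only the new last coordinate changes. *)
Lemma gray_consecutive (s : nat) (i i' : 'I_(2 ^ s.+1)) :
  i' = i.+1 :> nat ->
  differ_once (row i (gray_succ R s)) (row i' (gray_succ R s)).
Proof.
elim: s i i' => [|s IH] i i' ii'; first by exists ord0 => k; rewrite [k]ord1.
have e2 := gray_rows s.+1; have i2 := ltn_ord i'; have i1 := ltn_ord i.
rewrite /=; case: (ltngtP i' (2 ^ s.+1)%N) => ci.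
- have il : (i < 2 ^ s.+1)%N by lia.
  apply: (@differ_once_same_half _ _ i i' (Ordinal il) (Ordinal ci)).
  + by left.
  + by left.
  + by lia.
  + exact: IH.
- have il : ((2 ^ s.+2).-1 - i < 2 ^ s.+1)%N by lia.
  have il' : ((2 ^ s.+2).-1 - i' < 2 ^ s.+1)%N by lia.
  apply: (@differ_once_same_half _ _ i i' (Ordinal il) (Ordinal il')).
  + by right => /=; lia.
  + by right => /=; lia.
  + by lia.
  + by apply/differ_once_sym/IH => /=; lia.
- have il : (i < 2 ^ s.+1)%N by lia.
  apply: (@differ_once_mirror _ _ i i' (Ordinal il)); first by left.
  by right => /=; lia.
Qed.

(** The last row and the first one are the two copies of row [0] of the smaller
    code, so the closing step also changes only the last coordinate. *)
Lemma gray_cyclic (r : nat) (i : 'I_(2 ^ r)) :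
  (0 < r)%N -> differ_once (gray_code R i) (gray_code R (ordS i)).
Proof.
case: r i => // s i _; have i1 := ltn_ord i.
have [iS|iS] := ltnP i.+1 (2 ^ s.+1)%N.
  by apply: gray_consecutive; rewrite /= modn_small.
have ie : i.+1 = (2 ^ s.+1)%N by lia.
have oe : ordS i = 0%N :> nat by rewrite /= ie modnn.
case: s i i1 iS ie oe => [|s] i i1 iS ie oe.
  by exists ord0 => k; rewrite [k]ord1.
have p0 : (0 < 2 ^ s.+1)%N by rewrite expn_gt0.
apply: (@differ_once_mirror _ _ i (ordS i) (Ordinal p0)); last by left.
by right => /=; lia.
Qed.

End Gray.

Theorem proposition4 (R : realType) (r : nat) (hr : (0 < r)%N)
    (lam : 'rV[R]_(2 * 2 ^ r)%N) (z : 'rV[R]_r) :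
  Q (@annulus (2 ^ r)%N) (@gray_code R r) (lam, z) <->
  (forall k : 'I_r,
     \sum_(i < 2 ^ r)
        Num.min (gray_code R i 0 k) (gray_code R (ordS i) 0 k)
          * (lam 0 (vtx1 i) + lam 0 (vtx2 i))
     <= z 0 k
     <= \sum_(i < 2 ^ r)
          Num.max (gray_code R i 0 k) (gray_code R (ordS i) 0 k)
            * (lam 0 (vtx1 i) + lam 0 (vtx2 i)))
  /\ simplex lam.
Proof. by apply: Q_annulus => i; apply: gray_cyclic. Qed.
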